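(* Let $X$ be a Banach space, let $I=[0,1]$, and let $D\subset X$ be a dense linear subspace. Suppose that for each $t\in I$ the linear operator $A(t):D\subset X\to X$ (with domain $D$ independent of $t$) is closed and that $A(t)$ has a bounded inverse. For $s,t\in I$ put $C(t,s):=A(t)A(s)^{-1}-1$. Then the following two conditions, (Y) and (C$^1$), are equivalent. (Y) All three of the following hold: (i) for every $x\in X$ the map $\{(s',t')\in I^2: s'\neq t'\}\ni(s,t)\mapsto \frac{1}{t-s}\,C(t,s)x\in X$ is bounded and uniformly continuous; (ii) for every $x\in X$ the limit $C(t)x:=\lim_{k\to\infty}k\,C\bigl(t,t-\tfrac1k\bigr)x$ exists uniformly in $t\in(0,1]$; (iii) for every $x\in X$ the map $(0,1]\ni t\mapsto C(t)x\in X$ is continuous. (C$^1$) For every $x\in D$ the map $I\ni t\mapsto A(t)x\in X$ is continuously differentiable in the norm of $X$.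
   Context: ''$A(t)$ has a bounded inverse'' means that $A(t):D\to X$ is bijective and $A(t)^{-1}:X\to X$ is a bounded linear operator. In $C(t,s)$ the symbol $1$ denotes the identity operator on $X$. In (ii), $k$ runs through the positive integers, and ''exists uniformly in $t\in(0,1]$'' means: the limit exists for every $t\in(0,1]$ (only $k\ge 1/t$ are considered, so that $t-\frac1k\in I$), and $\sup_{t\in[\frac1k,1]}\bigl\|k\,C(t,t-\frac1k)x-C(t)x\bigr\|\to0$ as $k\to\infty$. Derivatives at the endpoints of $I=[0,1]$ are one-sided. *)

(* Defs.v *)
From HB Require Import structures.
From mathcomp Require Import all_boot all_order all_algebra.
From mathcomp Require Import all_classical all_reals all_analysis.
From mathcomp Require Import complex.

Set Implicit Arguments.
Unset Strict Implicit.
Unset Printing Implicit Defensive.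

Import Order.TTheory GRing.Theory Num.Theory.
Import numFieldNormedType.Exports.

Local Open Scope classical_set_scope.
Local Open Scope ring_scope.

(* A Banach space is taken over the reals or over the complex numbers; the time
   parameter is real in both cases. *)
Variant scalar_kind := real_scalars | complex_scalars.

Definition scalar_field (R : realType) (sk : scalar_kind) : numFieldType :=
  match sk with
  | real_scalars => R
  | complex_scalars => R[i]
  end.

Definition of_real (R : realType) (sk : scalar_kind) (r : R) :
    scalar_field R sk :=
  match sk return scalar_field R sk with
  | real_scalars => r
  | complex_scalars => (r%:C)%C
  end.

(* An operator with domain D is represented by a total function T : X -> X;
   none of the notions below depends on the values of T outside D. *)
Section Operators.
Context {K : numFieldType} {X : normedModType K}.
Implicit Types (D : set X) (T S : X -> X).

Definition linear_on D T :=
  forall (a : K) (x y : X), D x -> D y -> T (a *: x + y) = a *: T x + T y.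

Definition closed_operator D T :=
  closed [set p : X * X | D p.1 /\ p.2 = T p.1].

Definition bounded_linear S :=
  linear S /\ exists M : K, forall x, `|S x| <= M * `|x|.

(* The inverse of T : D -> X, with values in D as soon as T : D -> X is
   bijective. *)
Definition op_inv D T : X -> X := 'pinv_(fun=> 0) D T.

Definition has_bounded_inverse D T :=
  set_bij D setT T /\ bounded_linear (op_inv D T).

End Operators.

Section Conditions.
Context {R : realType} {sk : scalar_kind}.
Context {X : completeNormedModType (scalar_field R sk)}.
Implicit Types (D : set X) (A : R -> X -> X) (x : X).

Definition Cop D A (t s : R) x : X := A t (op_inv D (A s) x) - x.

(* p = (s, t) is sent to (t - s)^-1 C(t, s) x. *)
Definition Cquot D A x (p : R * R) : X :=
  of_real sk (p.2 - p.1)^-1 *: Cop D A p.2 p.1 x.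

Definition off_diagonal : set (R * R) :=
  [set p | p.1 \in `[0, 1] /\ p.2 \in `[0, 1] /\ p.1 != p.2].

Definition Cseq D A x (t : R) (k : nat) : X :=
  of_real sk k%:R *: Cop D A t (t - k%:R^-1) x.

Definition Clim D A x (t : R) : X := lim (Cseq D A x t k @[k --> \oo]).

Definition condY_i D A := forall x,
  [bounded Cquot D A x p | p in off_diagonal] /\
  unif_continuous (Cquot D A x : subspace off_diagonal -> X).

Definition condY_ii D A := forall x,
  (forall t : R, t \in `]0, 1] -> cvg (Cseq D A x t k @[k --> \oo])) /\
  (forall e : scalar_field R sk, 0 < e -> \forall k \near \oo,
     forall t : R, t \in `[k%:R^-1, 1] ->
       `|Cseq D A x t k - Clim D A x t| <= e).

Definition condY_iii D A := forall x,
  {within `]0, 1], continuous (Clim D A x)}.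

Definition condY D A := [/\ condY_i D A, condY_ii D A & condY_iii D A].

(* The norm derivative of u at t relative to [0, 1], hence one-sided at 0 and
   at 1. *)
Definition has_derivative_01 (u : R -> X) (t : R) (l : X) :=
  of_real sk (s - t)^-1 *: (u s - u t) @[s --> within `[0, 1] t^'] --> l.

Definition C1_01 (u : R -> X) := exists u' : R -> X,
  (forall t : R, t \in `[0, 1] -> has_derivative_01 u t (u' t)) /\
  {within `[0, 1], continuous u'}.

Definition condC1 D A := forall x, D x -> C1_01 (fun t => A t x).

End Conditions.

(* Main.v *)
(* Both conditions amount to this: for every x the quotients
   (t - s)^-1 C(t, s) x extend from the off-diagonal part of [0,1]^2 to a continuous
   function G_x on the whole square.  From (Y), G_x is the extension by uniform
   continuity; conversely G_x is uniformly continuous by Heine-Cantor and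
   C(t) x = G_x(t, t).
   The operators A(t) A(s)^-1 are everywhere defined with closed graph, so a Baire
   argument bounds the difference quotients uniformly, and x |-> G_x is Lipschitz
   uniformly on the square.  Given G, the derivative of A(t) x at t is then
   G_{A(t) x}(t, t), which is continuous in t.  Given (C^1), put B(t) = A(t) A(0)^-1;
   by the mean value inequality the divided differences of B(.) z are continuous on
   the square, and G_x(s, t) is the one with z = B(s)^-1 x.  Complex scalars are
   restricted to the reals. *)
Require Import Defs.
From HB Require Import structures.
From mathcomp Require Import all_boot all_order all_algebra.
From mathcomp Require Import all_classical all_reals all_analysis.
From mathcomp Require Import complex ring lra.

Import Order.TTheory GRing.Theory Num.Theory.
Import numFieldNormedType.Exports.

Local Open Scope classical_set_scope.
Local Open Scope ring_scope.

Set Implicit Arguments.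
Unset Strict Implicit.
Unset Printing Implicit Defensive.

(** * Real numbers inside the scalar field, and restriction of scalars *)

Section ScalarField.
Context {R : realType} {sk : scalar_kind}.
Implicit Types (a b : R) (z : scalar_field R sk).

Lemma of_real_is_zmod_morphism : zmod_morphism (@of_real R sk).
Proof. by case: sk => a b //=; rewrite (rmorphB (real_complex R)). Qed.

Lemma of_real_is_monoid_morphism : GRing.monoid_morphism (@of_real R sk).
Proof.
by split=> [|a b]; case: sk => //=; rewrite (rmorphM (real_complex R)).
Qed.

Definition to_real z : R :=
  match sk return scalar_field R sk -> R with
  | real_scalars => id
  | complex_scalars => @complex.Re R
  end z.

Lemma of_realK : cancel (@of_real R sk) to_real.
Proof. by rewrite /to_real; case: sk. Qed.

(** In the order of [R[i]] a nonnegative element has imaginary part zero. Norms are therefore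
    recovered from their real parts. *)
Lemma to_realK z : 0 <= z -> of_real sk (to_real z) = z.
Proof.
rewrite /to_real; case: sk z => //= -[a b].
by rewrite lecE /= => /andP[/eqP/= -> _].
Qed.

Lemma ler_of_real a b : (of_real sk a <= of_real sk b) = (a <= b).
Proof. by case: sk => //=; rewrite lecR. Qed.

Lemma ltr_of_real a b : (of_real sk a < of_real sk b) = (a < b).
Proof. by case: sk => //=; rewrite ltcR. Qed.

Lemma normr_of_real a : `|of_real sk a| = of_real sk `|a|.
Proof. by case: sk => //=; rewrite normc_def /= expr0n /= addr0 sqrtr_sqr. Qed.

End ScalarField.

HB.instance Definition _ (R : realType) (sk : scalar_kind) :=
  GRing.isZmodMorphism.Build R (scalar_field R sk) (@of_real R sk)
    (@of_real_is_zmod_morphism R sk).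

HB.instance Definition _ (R : realType) (sk : scalar_kind) :=
  GRing.isMonoidMorphism.Build R (scalar_field R sk) (@of_real R sk)
    (@of_real_is_monoid_morphism R sk).

(* The real Banach space underlying X, with the uniform structure of X itself,
   so that topological statements about X and about [realify X] are convertible. *)
Definition realify (R : realType) (sk : scalar_kind)
  (X : completeNormedModType (scalar_field R sk)) : Type := X.

Section Realify.
Context {R : realType} {sk : scalar_kind}.
Variable X : completeNormedModType (scalar_field R sk).
Let Y := realify X.
Let toX (x : Y) : X := x.

HB.instance Definition _ := PreUniformZmodule.copy Y X.
HB.instance Definition _ := Complete.copy Y X.

Let scale (a : R) (x : Y) : Y := of_real sk a *: toX x.

Let scaleA a b v : scale a (scale b v) = scale (a * b) v.
Proof. by rewrite /scale /toX scalerA rmorphM. Qed.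
Let scale1 : left_id 1 scale.
Proof. by move=> v; rewrite /scale rmorph1 scale1r. Qed.
Let scaleDr : right_distributive scale +%R.
Proof. by move=> a u v; exact: scalerDr. Qed.
Let scaleDl v : {morph scale^~ v : a b / a + b}.
Proof. by move=> a b; rewrite /scale rmorphD; exact: scalerDl. Qed.

HB.instance Definition _ :=
  GRing.Zmodule_isLmodule.Build R Y scaleA scale1 scaleDr scaleDl.

Let norm (x : Y) : R := to_real `|toX x|.

Let of_real_norm x : of_real sk (norm x) = `|toX x|.
Proof. by rewrite to_realK. Qed.

Let ler_normD x y : norm (x + y) <= norm x + norm y.
Proof.
rewrite -(ler_of_real (sk := sk)) rmorphD /= !of_real_norm; exact: ler_normD.
Qed.
Let normr0_eq0 x : norm x = 0 -> x = 0.
Proof.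
move=> x0; apply: (@normr0_eq0 _ X).
by rewrite -[LHS]of_real_norm x0 rmorph0.
Qed.
Let normrMn x n : norm (x *+ n) = norm x *+ n.
Proof.
apply: (can_inj (@of_realK R sk)).
by rewrite rmorphMn /= !of_real_norm; exact: normrMn.
Qed.
Let normrN x : norm (- x) = norm x.
Proof. by rewrite /norm /toX normrN. Qed.

HB.instance Definition _ :=
  Num.Zmodule_isNormed.Build R Y ler_normD normr0_eq0 normrMn normrN.

Let ball (x : Y) (e : R) (y : Y) : Prop := ball_ (fun x : Y => `|x|) x e y.

(** Every positive scalar is the image of a positive real, so real radii generate the same
    entourages as radii in the scalar field. This lets the real norm sit on the unchanged uniform
    structure of [X]. *)
Let entourage_ballE : entourage = entourage_ ball :> set_system (Y * Y).
Proof.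
rewrite -(@entourage_ballE _ X) !entourage_E.
apply/seteqP; split=> E [e /= e0 eE].
  exists (to_real e) => /=.
    by rewrite -(ltr_of_real (sk := sk)) to_realK ?rmorph0 ?ltW.
  move=> xy /= xye; apply: eE; rewrite -ball_normE /= -(to_realK (ltW e0)).
  by rewrite -[X in X < _]of_real_norm ltr_of_real.
exists (of_real sk e) => /=; first by rewrite -(rmorph0 (of_real sk)) ltr_of_real.
move=> xy; rewrite -ball_normE /= -[X in X < _]of_real_norm ltr_of_real.
exact: eE.
Qed.

HB.instance Definition _ := @Uniform_isPseudoMetric.Build R Y ball
  (@ball_norm_center _ _) (@ball_norm_symmetric _ _)
  (@ball_norm_triangle _ _) entourage_ballE.

HB.instance Definition _ := NormedZmod_PseudoMetric_eq.Build R Y erefl.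

Let normrZ (a : R) (x : Y) : `|a *: x| = `|a| * `|x|.
Proof.
apply: (can_inj (@of_realK R sk)).
by rewrite rmorphM /= -normr_of_real !of_real_norm; exact: normrZ.
Qed.

HB.instance Definition _ :=
  PseudoMetricNormedZmod_Lmodule_isNormedModule.Build R Y normrZ.

Lemma of_real_norm_realify (x : Y) : of_real sk `|x| = `|toX x|.
Proof. exact: of_real_norm. Qed.
End Realify.

(** * Uniform continuity on subsets: Heine-Cantor and extension to the closure *)

Section UniformContinuity.
Variables T U : uniformType.
Implicit Types (A : set T) (f : T -> U).

(** The subspace uniformity adds to the pairs inside [A] only the diagonal, and the diagonal is
    harmless since entourages are reflexive. *)
Lemma unif_continuous_subspaceP A f :
  unif_continuous (f : subspace A -> U) <->
  forall V, entourage V -> exists2 E, entourage E &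
    forall x y, A x -> A y -> E (x, y) -> V (f x, f y).
Proof.
split=> [fu V /fu[E entE EV]|fu V entV].
  exists E => // x y Ax Ay Exy.
  by apply: (EV (x, y)); right.
have [E entE EV] := fu V entV.
exists E => // -[x y] /= [->|[Ax [Ay Exy]]]; last exact: EV.
exact: entourage_refl.
Qed.

Lemma unif_continuous_subspaceW A B f : A `<=` B ->
  unif_continuous (f : subspace B -> U) -> unif_continuous (f : subspace A -> U).
Proof.
move=> AB /unif_continuous_subspaceP fu.
apply/unif_continuous_subspaceP => V /fu[E entE EV].
by exists E => // x y /AB Bx /AB By; exact: EV.
Qed.

Lemma eq_unif_continuous_subspace A f g : {in A, f =1 g} ->
  unif_continuous (f : subspace A -> U) -> unif_continuous (g : subspace A -> U).
Proof.
move=> fg /unif_continuous_subspaceP fu.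
apply/unif_continuous_subspaceP => V /fu[E entE EV].
by exists E => // x y Ax Ay Exy; rewrite -!fg ?inE//; exact: EV.
Qed.

Lemma unif_continuous_continuous A f :
  unif_continuous (f : subspace A -> U) -> {within A, continuous f}.
Proof.
move=> /unif_continuous_subspaceP fu; apply/subspace_continuousP => x Ax.
apply/cvg_app_entourageP => V /fu[E entE EV].
apply: filterS (nbhs_entourage x entE) => y /xsectionP Exy Ay; exact: EV.
Qed.

(** Heine-Cantor, with compactness in its near-covering form: what holds for all points near each
    [x] and all small entourages holds for one entourage on all of [A]. *)
Lemma compact_unif_continuous A f :
  compact A -> {within A, continuous f} -> unif_continuous (f : subspace A -> U).
Proof.
move=> /compact_near_coveringP cA /subspace_continuousP fc.
apply/unif_continuous_subspaceP => V entV.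
(* The empty set is treated apart: a point is what makes the filter of entourages proper. *)
have [->|/set0P[x0 _]] := eqVneq A set0.
  by exists setT; first exact: entourageT.
have PF : ProperFilter (@entourage T).
  apply: Build_ProperFilter_ex => E entE.
  by exists (x0, x0); exact: entourage_refl.
pose P (E : set (T * T)) x := forall y, A x -> A y -> E (x, y) -> V (f x, f y).
have FF : Filter (powerset_filter_from (@entourage T)).
  exact: powerset_filter_from_filter.
have : \forall E \near powerset_filter_from (@entourage T), forall x, A x -> P E x.
  apply: cA => x Ax.
  (* Both [f x'] and [f y] will be compared with [f x]; the symmetric half [W] of [V] allows passing
     through [f x] in either direction. *)
  pose W := split_ent V `&` (split_ent V)^-1%relation.
  have entW : entourage W by exact/entourage_invI/entourage_split_ent.
  have /cvg_app_entourageP/(_ _ entW)/nbhsP[E entE EW] := fc x Ax.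
  near=> x' E' => y Ax' Ay E'x'y.
  have Exx' : split_ent E (x, x').
    apply/xsectionP; near: x'; exact/nbhs_entourage/entourage_split_ent.
  have E'E : E' `<=` split_ent E.
    by near: E'; exact/small_set_sub/entourage_split_ent.
  have [_ Wx'] : W (f x, f x').
    apply: EW Ax'; apply/xsectionP; exact: split_ent_subset.
  have [Wy _] : W (f x, f y).
    apply: EW Ay; apply/xsectionP.
    by apply: (entourage_split (x')) => //; exact: E'E.
  exact: (entourage_split (f x)).
case=> S [Ssub _ [E SE]] SP.
by exists E; [exact: Ssub|move=> x y Ax; exact: (SP _ SE)].
Unshelve. all: by end_near. Qed.

End UniformContinuity.

(** At a point of the closure, [g] is the limit of [f] along the trace of the neighbourhoods on [A];
    that trace has a Cauchy image under [f], and [U] is complete. Outside the closure [g] takes the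
    value of [f] by default. *)
Lemma unif_continuous_extension (T : uniformType) (U : completeType)
    (A : set T) (f : T -> U) : unif_continuous (f : subspace A -> U) ->
  exists2 g : T -> U, {in A, f =1 g} & {within closure A, continuous g}.
Proof.
move=> /[dup] /unif_continuous_continuous/subspace_continuousP fc
  /unif_continuous_subspaceP fu.
have [g gP] : {g : T -> U & forall x,
    (A x -> f x = g x) /\ (closure A x -> f @ within A (nbhs x) --> g x)}.
  apply: (@choice _ _ (fun x y => (A x -> f x = y) /\
    (closure A x -> f @ within A (nbhs x) --> y))).
  move=> x; have [Ax|nAx] := pselect (A x).
    by exists (f x); split=> // _; exact: fc.
  have [clAx|] := pselect (closure A x); last by exists (f x).
  have PF : ProperFilter (within A (nbhs x)) by exact: within_nbhs_proper.
  suff /cvg_ex[y fy] : cvg (f @ within A (nbhs x)) by exists y.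
  apply: cauchy_cvg => V /fu[E entE EV].
  (* Two points of [N] are [E]-close through [x], so their images are [V]-close. *)
  pose N : set T := xsection (split_ent E `&` (split_ent E)^-1%relation) x.
  have NV : (f @ within A (nbhs x)) (f @` (A `&` N)).
    apply: filterS (nbhs_entourage x (entourage_invI (entourage_split_ent entE))).
    by move=> y Ny Ay; exists y.
  exists (f @` (A `&` N), f @` (A `&` N)) => // -[u v] /=.
  move=> [[y [Ay /xsectionP[_ Ey]] <-] [z [Az /xsectionP[Ez _]] <-]].
  by apply: EV => //; exact: (entourage_split (x)).
exists g => [x /set_mem Ax|]; first exact: (gP x).1.
apply: unif_continuous_continuous; apply/unif_continuous_subspaceP => V entV.
pose V1 := split_ent V; pose V2 := split_ent V1.
have entV1 : entourage V1 by exact: entourage_split_ent.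
have entV2 : entourage V2 by exact: entourage_split_ent.
have [E entE EV] := fu _ entV2.
pose E1 := split_ent E; pose E2 := split_ent E1.
have entE1 : entourage E1 by exact: entourage_split_ent.
have entE2 : entourage E2 by exact: entourage_split_ent.
exists E2 => // x y clx cly Exy.
have PFx : ProperFilter (within A (nbhs x)) by exact: within_nbhs_proper.
have PFy : ProperFilter (within A (nbhs y)) by exact: within_nbhs_proper.
(* Points [a] and [b] of [A] near [x] and [y] give the chain [g x], [f a], [f b], [g y]. Two
   quarters and a half of [V] add up along it, and likewise for [E] along [a], [x], [y], [b]. *)
have [a [[Va Ea] Aa]] : exists a, (V2 (g x, f a) /\ E2 (a, x)) /\ A a.
  apply: (@filter_ex _ (within A (nbhs x))).
  apply: filterI; last exact: withinT.
  apply: filterI; first by have /cvg_app_entourageP := (gP x).2 clx; exact.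
  apply: filterS (nbhs_entourage x (entourage_inv entE2)).
  by move=> a /xsectionP.
have [b [[Vb Eb] Ab]] : exists b, (V1 (f b, g y) /\ E1 (y, b)) /\ A b.
  apply: (@filter_ex _ (within A (nbhs y))).
  apply: filterI; last exact: withinT.
  apply: filterI.
    have /cvg_app_entourageP/(_ _ (entourage_inv entV1)) := (gP y).2 cly.
    exact.
  apply: filterS (nbhs_entourage y entE1).
  by move=> b /xsectionP.
apply: (entourage_split (f b)) => //.
apply: (entourage_split (f a)) => //.
apply: EV => //; apply: (entourage_split (y)) => //.
exact: (entourage_split (x)).
Qed.

(** * Uniform boundedness for linear operators with closed graph *)

Section UniformBoundedness.
Context {R : realType} {V W : completeNormedModType R}.

(** The iteration of the open mapping theorem: approximating each remainder in turn writes [x] as a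
    series of terms [u n] with [f (u n)] of norm at most [K * |x| / 2^n]. The images are summable,
    the closed graph identifies their sum with [f x], and the geometric series gives the factor
    2. *)
Lemma closed_graph_approx_bound (f : {linear V -> W}) (K : R) :
  closed [set p : V * W | p.2 = f p.1] ->
  (forall y e, 0 < e -> exists2 u, `|y - u| < e & `|f u| <= K * `|y|) ->
  forall x, `|f x| <= 2 * K * `|x|.
Proof.
move=> clf approx x.
have [->|x0] := eqVneq x 0; first by rewrite linear0 !normr0 mulr0.
have nx0 : 0 < `|x| by rewrite normr_gt0.
pose e n := `|x| * 2^-1 ^+ n : R.
have e0 n : 0 < e n by rewrite mulr_gt0// exprn_gt0.
have half1 : `|2^-1 : R| < 1 by rewrite ger0_norm ?invr_ge0// invf_lt1// ltr1n.
have K0 : 0 <= K.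
  have [u _ fu] := approx x 1 ltr01.
  by rewrite -(pmulr_lge0 _ nx0) (le_trans _ fu).
have [g gP] : {g : nat * V -> V & forall p,
    `|p.2 - g p| < e p.1.+1 /\ `|f (g p)| <= K * `|p.2|}.
  apply: (@choice _ _ (fun p u => `|p.2 - u| < e p.1.+1 /\ `|f u| <= K * `|p.2|)).
  by move=> p; have [u ? ?] := approx p.2 _ (e0 p.1.+1); exists u.
(* [y n] is the remainder of [x] after [n] approximations, of norm at most [e n]. *)
pose fix y n := if n is m.+1 then y m - g (m, y m) else x.
pose u n := g (n, y n).
have yE n : `|y n| <= e n.
  case: n => [|n]; first by rewrite /e expr0 mulr1.
  exact/ltW/(gP (n, y n)).1.
have sumE n : series u n = x - y n.
  elim: n => [|n IHn]; first by rewrite /series/= big_geq// subrr.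
  by rewrite seriesSr IHn /= opprB addrA addrAC.
have y_cvg : y @ \oo --> (0 : V).
  apply/cvgr0Pnorm_lt => d d0.
  have /cvgr0Pnorm_lt geo := cvg_geometric `|x| half1.
  apply: filterS (geo d d0) => n /=; apply: le_lt_trans.
  by rewrite (le_trans (yE n))// ler_norm.
have sum_cvg : series u @ \oo --> x.
  rewrite (_ : series u = fun n => x - y n); last exact/funext.
  by rewrite -[X in _ --> X]subr0; apply: cvgB => //; exact: cvg_cst.
have fuE n : `|f (u n)| <= geometric (K * `|x|) 2^-1 n.
  rewrite (le_trans (gP (n, y n)).2)//= -mulrA; exact: ler_wpM2l.
have fu_cvg : cvgn [normed series (f \o u)].
  apply: (series_le_cvg _ _ fuE (is_cvg_geometric_series half1)) => n //.
  exact: le_trans (normr_ge0 _) (fuE n).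
have sfE : series (f \o u) = f \o series u.
  by apply/funext => n /=; rewrite /series /= linear_sum.
have /normed_cvg flim := fu_cvg.
have <- : limn (series (f \o u)) = f x.
  have sum_graph : \forall n \near \oo,
      [set p : V * W | p.2 = f p.1] (series u n, series (f \o u) n).
    by apply: nearW => n /=; rewrite sfE.
  have := closed_cvg _ clf sum_graph (x, limn (series (f \o u))).
  by apply; exact: cvg_pair.
apply: le_trans (lim_series_norm fu_cvg) _.
have -> : 2 * K * `|x| = limn (series (geometric (K * `|x|) 2^-1)).
  rewrite (cvg_lim _ (cvg_geometric_series half1))//.
  by field.
by apply: lim_series_le => //; exact: is_cvg_geometric_series.
Qed.

(* A common generalization of the closed graph theorem (one operator) and of the
   Banach-Steinhaus theorem (continuous operators). *)
Lemma closed_graph_uniform_boundedness (F : set (V -> W)) :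
  (forall f, F f -> linear f /\ closed [set p : V * W | p.2 = f p.1]) ->
  pointwise_bounded F ->
  exists2 M, 0 <= M & forall f, F f -> forall x, `|f x| <= M * `|x|.
Proof.
move=> FP Fb.
pose E n : set V := [set x | forall f, F f -> `|f x| <= n%:R].
(* The sets [E n] cover [V] by pointwise boundedness. If no closure contained a ball, the open dense
   complements of the closures would have a common point by Baire. *)
have [n [x0 [r r0 ballE]]] : exists n x0, exists2 r : R, 0 < r &
    ball x0 r `<=` closure (E n).
  apply: contrapT => nE.
  have Ed : forall n, open (~` closure (E n)) /\ dense (~` closure (E n)).
    move=> n; split; first exact/closed_openC/closed_closure.
    apply: contrapT => /denseNE[B [[x /open_nbhs_nbhs/nbhs_ballP[r /= r0 rB]] B0]].
    apply: nE; exists n, x, r => // y /rB By; apply: contrapT => nEy.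
    by have : set0 y by rewrite -B0.
  have [|z [_ zE]] := Baire Ed (O := setT) _ openT; first by exists 0.
  have [M zM] := Fb z.
  apply: (zE (Num.truncn M).+1 I); apply: subset_closure => f Ff.
  by rewrite (le_trans (zM f Ff))// ltW// truncnS_gt.
(* The centre is moved to the origin: [y] is approximated by the difference of a point of [E n] near
   [x0 + y] and one near [x0], which doubles the bound. *)
have approx0 y e : `|y| < r -> 0 < e -> exists2 u, `|y - u| < e &
    forall f, F f -> `|f u| <= 2 * n%:R.
  move=> yr e0; have e20 : 0 < e / 2 by rewrite divr_gt0.
  have clball z : `|z| < r -> exists2 u, E n u & `|x0 + z - u| < e / 2.
    move=> zr; have /ballE cl : ball x0 r (x0 + z).
      by rewrite -ball_normE /= opprD addNKr normrN.
    have [u [Eu]] := cl _ (nbhsx_ballx _ _ e20).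
    by rewrite -ball_normE /=; exists u.
  have [u Eu uy] := clball y yr.
  have [|v Ev v0] := clball 0; first by rewrite normr0.
  exists (u - v) => [|f Ff].
    rewrite (_ : y - (u - v) = (x0 + y - u) - (x0 + 0 - v)).
      by rewrite (le_lt_trans (ler_normB _ _))// (splitr e) ltrD.
    by rewrite addr0 !opprB [RHS]addrC !addrA subrK addrAC addrC !addrA addrC.
  have [lf _] := FP f Ff.
  pose g : {linear V -> W} := HB.pack f (GRing.isLinear.Build _ _ _ _ _ lf).
  rewrite -[f]/(g : V -> W) linearB (le_trans (ler_normB _ _))//.
  by rewrite [2 * _]mulr_natl mulr2n lerD//; [exact: Eu|exact: Ev].
(* A nonzero [y] is scaled by [c] to norm [r / 2]; undoing this turns the bound [2 * n] into
   [2 * n / c], that is [K * |y|]. *)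
pose K := 4 * n%:R / r.
exists (2 * K) => [|f Ff]; first by rewrite !mulr_ge0// invr_ge0 ltW.
have [lf clf] := FP f Ff.
pose g : {linear V -> W} := HB.pack f (GRing.isLinear.Build _ _ _ _ _ lf).
apply: (@closed_graph_approx_bound g) => // y e e0.
have [->|y0] := eqVneq y 0.
  by exists 0; rewrite ?subrr ?linear0 ?normr0 ?mulr0.
have ny0 : 0 < `|y| by rewrite normr_gt0.
pose c := r / (2 * `|y|).
have c0 : 0 < c by rewrite divr_gt0// mulr_gt0.
have [||u ucy fu] := @approx0 (c *: y) (c * e).
- rewrite normrZ gtr0_norm// /c invfM mulrA divfK ?gt_eqF//.
  by rewrite ltr_pdivrMr// ltr_pMr// ltr1n.
- exact: mulr_gt0.
exists (c^-1 *: u).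
  rewrite -(ltr_pM2l c0) -[X in X * `|_|](gtr0_norm c0) -normrZ scalerBr.
  by rewrite scalerA divff ?gt_eqF// scale1r.
rewrite linearZ normrZ gtr0_norm ?invr_gt0// ler_pdivrMl// (le_trans (fu _ Ff))//.
rewrite /c /K le_eqVlt; apply/orP; left; apply/eqP.
by field; rewrite gt_eqF//= gt_eqF.
Qed.

End UniformBoundedness.

(** * Calculus on the unit interval: the mean value inequality and divided differences *)

(** Continuous induction: the supremum of the points reachable from [a] is reached by the local
    hypothesis on its left, and equals [b] because the hypothesis on its right would lead beyond
    it. *)
Lemma segment_transitive_local {R : realType} (P : R -> R -> Prop) (a b : R) :
  a <= b ->
  (forall x y z, x <= y -> y <= z -> P x y -> P y z -> P x z) ->
  (forall c, a <= c <= b -> exists2 d, 0 < d & forall x y, a <= x -> y <= b ->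
     c - d < x -> x <= c -> c <= y -> y < c + d -> P x c /\ P c y) ->
  P a b.
Proof.
move=> ab Ptrans Plocal.
pose S : set R := [set x | a <= x <= b /\ P a x].
have Sa : S a.
  have [|d d0 Pd] := Plocal a; first by rewrite lexx.
  split; first by rewrite lexx.
  by apply: (Pd a a _ _ _ _ _ _).1 => //; lra.
have supS : has_sup S.
  by split; [exists a|exists b => x [/andP[_ xb] _]].
have Sge x : S x -> x <= sup S by exact: sup_upper_bound.
have ac : a <= sup S by exact: Sge.
have cb : sup S <= b by apply: ge_sup; [exists a|move=> x [/andP[_ xb] _]].
have [|d d0 Pd] := Plocal (sup S); first by rewrite ac.
have [x [/andP[ax xb] Pax] cdx] := sup_adherent d0 supS.
have xc : x <= sup S by apply: Sge; rewrite /S /= ax.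
have Pac : P a (sup S).
  apply: (Ptrans _ x) => //.
  by apply: (Pd x (sup S) _ _ _ _ _ _).1 => //; lra.
have [<-//|cb'] := eqVneq (sup S) b.
have {cb'} cltb : sup S < b by rewrite lt_neqAle cb'.
pose y := Num.min b (sup S + d / 2).
have cy : sup S < y by rewrite /y lt_min cltb/=; lra.
have yb : y <= b by rewrite /y ge_min lexx.
have yd : y < sup S + d by rewrite /y gt_min; apply/orP; right; lra.
suff : y <= sup S by rewrite leNgt cy.
apply: Sge; split; first by rewrite yb andbT; lra.
apply: (Ptrans _ (sup S)) => //; first exact: ltW.
by apply: (Pd (sup S) y _ _ _ _ _ _).2 => //; lra.
Qed.

Definition square01 {R : realType} : set (R * R) := `[0, 1] `*` `[0, 1].

Section Square01.
Context {R : realType}.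
Implicit Types p : R * R.

Lemma cvg_fst_square01 p :
  fst @ within square01 (nbhs p) --> within `[0, 1] (nbhs p.1).
Proof.
case: p => s t B nB.
have : nbhs (s, t) (fst @^-1` [set x | `[0, 1]%classic x -> B x]).
  exact: (@cvg_fst _ _ (nbhs s) (nbhs t) _ _ nB).
by apply: filterS => p h [/h].
Qed.

Lemma cvg_snd_square01 p :
  snd @ within square01 (nbhs p) --> within `[0, 1] (nbhs p.2).
Proof.
case: p => s t B nB.
have : nbhs (s, t) (snd @^-1` [set x | `[0, 1]%classic x -> B x]).
  exact: (@cvg_snd _ _ (nbhs s) (nbhs t) _ _ nB).
by apply: filterS => p h [_ /h].
Qed.

End Square01.

Section Derivative01.
Context {R : realType} {V : normedModType R}.
Implicit Types (u : R -> V) (s t : R) (l : V).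

(* The real case of [has_derivative_01]. *)
Definition is_derivative01 u t l :=
  (s - t)^-1 *: (u s - u t) @[s --> within `[0, 1] t^'] --> l.

(** Clearing the denominator lets the estimate include [s = t]. *)
Lemma is_derivative01_le u t l e : is_derivative01 u t l -> 0 < e ->
  exists2 d, 0 < d & forall s, s \in `[0, 1] -> `|s - t| < d ->
    `|u s - u t - (s - t) *: l| <= e * `|s - t|.
Proof.
move=> /cvgrPdist_le ul e0.
have /nbhs_ballP[d /= d0 dl] := ul e e0; exists d => // s s01 std.
have [->|st] := eqVneq s t; first by rewrite !subrr scale0r subr0 !normr0 mulr0.
have st0 : s - t != 0 by rewrite subr_eq0.
have := dl s; rewrite /ball /= distrC => /(_ std st s01) le.
rewrite distrC -[u s - u t](scalerKV st0) -scalerBr normrZ mulrC.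
by rewrite ler_wpM2r.
Qed.

Lemma is_derivative01_cvg u t l : t \in `[0, 1] -> is_derivative01 u t l ->
  u @ within `[0, 1] (nbhs t) --> u t.
Proof.
move=> t01 ul; apply/cvgrPdist_le => e e0.
have [d d0 dl] := is_derivative01_le ul ltr01.
pose M := 1 + `|l|; have M0 : 0 < M by rewrite ltr_wpDr.
rewrite near_withinE; near=> s => s01.
have std : `|s - t| < d.
  rewrite distrC; near: s; exact: (nbhsx_ballx t d d0).
have steM : `|s - t| <= e / M.
  rewrite distrC ltW//; near: s; apply: (nbhsx_ballx t).
  by rewrite divr_gt0.
rewrite distrC -[X in `|X|](subrK ((s - t) *: l)).
rewrite (le_trans (ler_normD _ _))// normrZ.
rewrite (le_trans (lerD (dl _ s01 std) (lexx _)))//.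
by rewrite [X in _ + X]mulrC -mulrDl -ler_pdivlMl// mulrC.
Unshelve. all: by end_near. Qed.

(** Vector values admit no intermediate point, but the inequality is additive over adjacent
    intervals, so it need only be checked around each point. The free vector [m] will be a value of
    [u']. *)
Lemma mean_value_le u (u' : R -> V) (m : V) (a b e : R) :
  a \in `[0, 1] -> b \in `[0, 1] -> a <= b ->
  (forall t, a <= t <= b -> is_derivative01 u t (u' t)) ->
  (forall t, a <= t <= b -> `|u' t - m| <= e) ->
  `|u b - u a - (b - a) *: m| <= e * (b - a).
Proof.
rewrite !in_itv /= => /andP[a0 a1] /andP[b0 b1] ab uu' u'm.
apply/ler_addgt0Pr => k k0.
(* The slack [k] in the slope pays for the remainder of the derivative at each point; over a length
   of at most 1 it costs at most [k]. *)
pose e' := e + k.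
suff : `|u b - u a - (b - a) *: m| <= e' * (b - a).
  move=> /le_trans; apply; rewrite /e' mulrDl lerD2l.
  by rewrite ler_piMr ?(ltW k0)//; lra.
apply: (segment_transitive_local
  (P := fun x y => `|u y - u x - (y - x) *: m| <= e' * (y - x)) ab).
  move=> x y z xy yz Pxy Pyz.
  have -> : u z - u x - (z - x) *: m =
      (u z - u y - (z - y) *: m) + (u y - u x - (y - x) *: m).
    rewrite addrACA -opprD -scalerDl [z - y + _]addrA subrK; congr (_ - _).
    by rewrite addrA subrK.
  have -> : e' * (z - x) = e' * (z - y) + e' * (y - x) by ring.
  exact: le_trans (ler_normD _ _) (lerD Pyz Pxy).
move=> c acb; have [ac cb] := andP acb.
have [d d0 ud] := is_derivative01_le (uu' c acb) k0.
have key y : a <= y <= b -> `|y - c| < d ->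
    `|u y - u c - (y - c) *: m| <= e' * `|y - c|.
  move=> /andP[ay yb] ycd.
  have -> : u y - u c - (y - c) *: m =
      (u y - u c - (y - c) *: u' c) + (y - c) *: (u' c - m).
    by rewrite scalerBr addrA subrK.
  rewrite (le_trans (ler_normD _ _))// /e' mulrDl addrC lerD//.
    by rewrite normrZ mulrC ler_wpM2r// u'm.
  by apply: ud => //; rewrite in_itv/=; lra.
exists d => // x y ax yb cdx xc cy ycd; split.
  have := key x; rewrite ler0_norm; last lra.
  rewrite opprB => h.
  have -> : u c - u x - (c - x) *: m = - (u x - u c - (x - c) *: m).
    by rewrite -(opprB x c) scaleNr opprK [RHS]opprB opprB addrC.
  by rewrite normrN; apply: h; lra.
have := key y; rewrite ger0_norm; last lra.
by apply; lra.
Qed.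

Definition divided_difference u (u' : R -> V) (p : R * R) : V :=
  if p.1 == p.2 then u' p.2 else (p.2 - p.1)^-1 *: (u p.2 - u p.1).

Lemma cvgVZ (T : Type) (F : set_system T) {FF : Filter F} (f : T -> R)
    (g : T -> V) (a : R) (b : V) : a != 0 -> f @ F --> a -> g @ F --> b ->
  (f x)^-1 *: g x @[x --> F] --> a^-1 *: b.
Proof. by move=> a0 fa gb; apply: cvgZ => //; exact: cvgV. Qed.

(** At the diagonal the mean value inequality, with [m] the derivative at the limit point, controls
    the quotients; elsewhere numerator and denominator converge separately. *)
Lemma divided_difference_continuous u u' :
  (forall t, t \in `[0, 1] -> is_derivative01 u t (u' t)) ->
  {within `[0, 1], continuous u'} ->
  {within square01, continuous (divided_difference u u')}.
Proof.
move=> uu' /subspace_continuousP u'c.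
apply/subspace_continuousP => -[s0 t0] [/= s01 t01]; rewrite /from_subspace.
have FF : Filter (within square01 (nbhs (s0, t0))) by exact: within_filter.
have [st|st] := eqVneq s0 t0.
  subst s0.
  rewrite [X in _ --> X]/divided_difference /= eqxx.
  apply/cvgrPdist_le => e e0.
  have /cvgrPdist_le/(_ e e0)/nbhs_ballP[d /= d0 u'd] := u'c t0 t01.
  have key s t : s \in `[0, 1] -> t \in `[0, 1] -> s < t ->
      `|s - t0| < d -> `|t - t0| < d ->
      `|(t - s)^-1 *: (u t - u s) - u' t0| <= e.
    move=> sI tI lt_st sd td.
    have ts0 : 0 < t - s by rewrite subr_gt0.
    move: (sI) (tI); rewrite !in_itv /= => /andP[s_ge0 s_le1] /andP[t_ge0 t_le1].
    have := mean_value_le sI tI (ltW lt_st)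
      (u := u) (u' := u') (m := u' t0) (e := e).
    rewrite -ler_pdivrMr// => h.
    have -> : (t - s)^-1 *: (u t - u s) - u' t0 =
        (t - s)^-1 *: (u t - u s - (t - s) *: u' t0).
      by rewrite [RHS]scalerBr scalerA mulVf ?gt_eqF// scale1r.
    rewrite normrZ gtr0_norm ?invr_gt0// mulrC; apply: h => r /andP[sr rt].
      by apply: uu'; rewrite in_itv/=; lra.
    rewrite distrC; apply: u'd; last by rewrite /= in_itv/=; lra.
    rewrite /ball /= distrC ltr_norml.
    by move: sd td; rewrite !ltr_norml; lra.
  rewrite near_withinE; near=> p => -[p1 p2].
  have [p1d p2d] : `|p.1 - t0| < d /\ `|p.2 - t0| < d.
    near: p; exists (ball t0 d, ball t0 d) => /=.
      by split; exact: nbhsx_ballx.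
    by move=> p [/=]; rewrite /ball /= !(distrC t0).
  (* The quotient is symmetric in its two points, so the case [p.2 < p.1] reduces to [key]. *)
  rewrite /divided_difference distrC; case: (ltgtP p.1 p.2) => [lt12|lt21|e12].
  - exact: key.
  - rewrite -(opprB p.1) -(opprB (u p.1)) invrN scaleNr scalerN opprK.
    exact: key.
  - by rewrite distrC; apply: u'd => //; rewrite /ball /= distrC.
have us0 := is_derivative01_cvg s01 (uu' _ s01).
have ut0 := is_derivative01_cvg t01 (uu' _ t01).
rewrite [X in _ --> X]/divided_difference /= (negbTE st).
have c1 : fst @ within square01 (nbhs (s0, t0)) --> within `[0, 1] (nbhs s0).
  exact: cvg_fst_square01.
have c2 : snd @ within square01 (nbhs (s0, t0)) --> within `[0, 1] (nbhs t0).
  exact: cvg_snd_square01.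
have c1' : fst @ within square01 (nbhs (s0, t0)) --> s0.
  exact/(cvg_trans c1)/cvg_within.
have c2' : snd @ within square01 (nbhs (s0, t0)) --> t0.
  exact/(cvg_trans c2)/cvg_within.
have ts0 : t0 - s0 != 0 by rewrite subr_eq0 eq_sym.
have c12 : (p.2 - p.1 : R) @[p --> within square01 (nbhs (s0, t0))] --> t0 - s0.
  exact: cvgB.
pose q p := (p.2 - p.1)^-1 *: (u p.2 - u p.1).
(* Near an off-diagonal point the diagonal branch of the definition never occurs. *)
have qE : \forall p \near within square01 (nbhs (s0, t0)),
    q p = divided_difference u u' p.
  near=> p; rewrite /divided_difference.
  have p12 : p.2 - p.1 != 0 by near: p; exact: cvgr_neq0 _ c12 ts0.
  by rewrite -subr_eq0 -oppr_eq0 opprB (negbTE p12).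
apply: cvg_trans (near_eq_cvg qE) _.
apply: cvgVZ => //.
by apply: cvgB; [exact: cvg_comp c2 ut0|exact: cvg_comp c1 us0].
Unshelve. all: by end_near. Qed.

End Derivative01.

(** * The unit square and its off-diagonal part *)

Section OffDiagonal.
Context {R : realType}.

Lemma off_diagonal_sub_square01 : @off_diagonal R `<=` square01.
Proof. by move=> p [? []]. Qed.

(** A diagonal point is left by shifting its first coordinate by [min (d / 2) (1 / 2)], to the right
    if it is at most [1 / 2] and to the left otherwise, which stays in the interval. *)
Lemma square01_sub_closure_off_diagonal : square01 `<=` closure (@off_diagonal R).
Proof.
move=> [s t] [/= s01 t01] B /nbhs_ballP[d /= d0 dB].
have [st|st] := eqVneq s t; last first.
  exists (s, t); split; first by [].
  by apply: dB; exact: ballxx.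
subst s; move: (t01); rewrite in_itv /= => /andP[t0 t1].
have [r r01 [rt rd]] : exists2 r, r \in `[0, 1] & r != t /\ `|t - r| < d.
  have [th|th] := leP t 2^-1.
    exists (t + Num.min (d / 2) 2^-1).
      rewrite in_itv /=; apply/andP; split.
        by rewrite addr_ge0// le_min; lra.
      have : Num.min (d / 2) 2^-1 <= 2^-1 by rewrite ge_min lexx orbT.
      lra.
    have m0 : 0 < Num.min (d / 2) 2^-1 by rewrite lt_min; lra.
    have md : Num.min (d / 2) 2^-1 <= d / 2 by rewrite ge_min lexx.
    split; first by rewrite -subr_eq0 addrC addKr gt_eqF.
    by rewrite opprD addNKr normrN gtr0_norm//; lra.
  exists (t - Num.min (d / 2) 2^-1).
    rewrite in_itv /=; apply/andP; split.
      have : Num.min (d / 2) 2^-1 <= 2^-1 by rewrite ge_min lexx orbT.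
      lra.
    have : 0 <= Num.min (d / 2) 2^-1 by rewrite le_min; lra.
    lra.
  have m0 : 0 < Num.min (d / 2) 2^-1 by rewrite lt_min; lra.
  have md : Num.min (d / 2) 2^-1 <= d / 2 by rewrite ge_min lexx.
  split; first by rewrite -subr_eq0 addrAC subrr sub0r oppr_eq0 gt_eqF.
  by rewrite opprB addrC subrK gtr0_norm//; lra.
exists (r, t); split; first by split.
apply: dB; split => //=; exact: ballxx.
Qed.

Lemma square01_compact : compact (@square01 R).
Proof. by apply: compact_setX; exact: segment_compact. Qed.

End OffDiagonal.

(** * Families of functions that are Lipschitz in a vector parameter *)

Section LipschitzFamilies.
Context {R : realType} {V : completeNormedModType R}.

Lemma within_continuous_norm_le (T : topologicalType) (S P : set T) (g : T -> V)
    (M : R) : P `<=` S -> S `<=` closure P -> {within S, continuous g} ->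
  (forall p, P p -> `|g p| <= M) -> forall p, S p -> `|g p| <= M.
Proof.
move=> PS SP /subspace_continuousP gc gM p Sp.
apply/ler_addgt0Pr => e e0.
have /cvgrPdist_le/(_ e e0) := gc p Sp.
rewrite near_withinE => /(SP p Sp)[x [Px]] /(_ (PS x Px)) le.
rewrite -[g p](subrK (g x)) addrC (le_trans (ler_normD _ _))// lerD//.
exact: gM.
Qed.

Lemma linear_subr (f : V -> V) : linear f -> {morph f : x y / x - y}.
Proof.
move=> lf x y.
pose g : {linear V -> V} := HB.pack f (GRing.isLinear.Build _ _ _ _ _ lf).
exact: (linearB g).
Qed.

Lemma linear_at0 (f : V -> V) : linear f -> f 0 = 0.
Proof. by move=> lf; have := linear_subr lf 0 0; rewrite !subrr. Qed.

Lemma bounded_linear_continuous (f : V -> V) (K : R) : linear f ->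
  (forall x, `|f x| <= K * `|x|) -> continuous f.
Proof.
move=> lf fK.
pose g : {linear V -> V} := HB.pack f (GRing.isLinear.Build _ _ _ _ _ lf).
apply: (linear_bounded_continuous g).1.
apply/linear_boundedP; near=> M => x.
rewrite (le_trans (fK x))// ler_wpM2r//.
Unshelve. all: end_near. Qed.

Lemma continuous_closed_graph (f : V -> V) : continuous f ->
  closed [set p : V * V | p.2 = f p.1].
Proof.
move=> fc.
have -> : [set p : V * V | p.2 = f p.1] = (fun p => p.2 - f p.1) @^-1` [set 0].
  apply/seteqP; split=> p /=; first by move=> ->; rewrite subrr.
  by move/eqP; rewrite subr_eq0 => /eqP.
apply: preimage_closed; last first.
  exact/accessible_closed_set1/hausdorff_accessible/norm_hausdorff.
move=> p _; apply: cvgB; first exact: cvg_snd.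
by apply: continuous_comp; [exact: cvg_fst|exact: fc].
Qed.

(** Continuity of [G x] on the compact square bounds the operators [q p] pointwise, hence uniformly
    in norm. The resulting Lipschitz estimate passes to the diagonal by density. *)
Lemma uniform_lipschitz (q : R * R -> V -> V) (G : V -> R * R -> V) :
  (forall p, off_diagonal p -> linear (q p)) ->
  (forall p, off_diagonal p -> exists K, forall x, `|q p x| <= K * `|x|) ->
  (forall x, {within square01, continuous (G x)}) ->
  (forall x p, off_diagonal p -> G x p = q p x) ->
  exists2 M, 0 <= M & forall p, square01 p ->
    forall x y, `|G x p - G y p| <= M * `|x - y|.
Proof.
move=> ql qb Gc Gq.
have [||M M0 qM] := @closed_graph_uniform_boundedness R V V (q @` off_diagonal).
- move=> _ [p op <-]; split; first exact: ql.
  have [K qK] := qb p op; apply: continuous_closed_graph.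
  exact: bounded_linear_continuous (ql p op) qK.
- move=> x.
  have := compact_bounded (continuous_compact (Gc x) square01_compact).
  (* Boundedness is a statement about the numbers strictly above [M], hence [M + 1]. *)
  move=> [M [_ /(_ (M + 1))GM]]; exists (M + 1) => _ [p op <-].
  rewrite -Gq//; apply: GM; first by rewrite ltrDl.
  by exists p => //; exact: off_diagonal_sub_square01.
exists M => // p sp x y.
apply: (@within_continuous_norm_le _ square01 off_diagonal
    (fun p => G x p - G y p)) sp => //.
- exact: off_diagonal_sub_square01.
- exact: square01_sub_closure_off_diagonal.
- by move=> z; apply: cvgB; exact: Gc.
move=> z oz; rewrite !Gq//.
by rewrite -(linear_subr (ql z oz)); apply: qM; exists z.
Qed.

Lemma lipschitz_family_continuous (T : topologicalType) (S : set T)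
    (G : V -> T -> V) (z : T -> V) (M : R) :
  (forall x, {within S, continuous (G x)}) ->
  (forall p, S p -> forall x y, `|G x p - G y p| <= M * `|x - y|) ->
  {within S, continuous z} -> {within S, continuous (fun p => G (z p) p)}.
Proof.
move=> Gc GM /subspace_continuousP zc; apply/subspace_continuousP => p Sp.
have /subspace_continuousP/(_ p Sp) Gpc := Gc (z p).
have FF : Filter (within S (nbhs p)) by exact: within_filter.
(* [M] has no prescribed sign; [k] is a positive Lipschitz constant above it. *)
apply/cvgrPdist_le => e e0; pose k := `|M| + 1.
have k0 : 0 < k by rewrite ltr_wpDl.
near=> x.
have Sx : S x by near: x; exact: withinT.
rewrite (_ : _ - _ = (G (z p) p - G (z p) x) + (G (z p) x - G (z x) x)); last first.
  by rewrite addrA subrK.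
rewrite (le_trans (ler_normD _ _))// (splitr e) lerD//.
  near: x; move/cvgrPdist_le : Gpc; apply; exact: divr_gt0.
rewrite (le_trans (GM x Sx _ _))//.
have zx : `|z p - z x| <= e / 2 / k.
  near: x; move/cvgrPdist_le : (zc p Sp); apply; do 2 apply: divr_gt0 => //.
rewrite (le_trans (ler_wpM2r _ (_ : M <= k)))//.
  by rewrite /k (le_trans (ler_norm M))// lerDl.
by rewrite mulrC -ler_pdivlMr.
Unshelve. all: by end_near. Qed.

End LipschitzFamilies.

(** * The equivalence over the reals, with [J t] in the role of the inverse of [A t] *)

Section RealCase.
Context {R : realType} {V : completeNormedModType R}.
Variables (D : set V) (A J : R -> V -> V).
Hypothesis A_linear : forall t, t \in `[0, 1] -> linear_on D (A t).
Hypothesis A_closed : forall t, t \in `[0, 1] -> closed_operator D (A t).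
Hypothesis J_linear : forall t, t \in `[0, 1] -> linear (J t).
Hypothesis J_continuous : forall t, t \in `[0, 1] -> continuous (J t).
Hypothesis J_dom : forall t, t \in `[0, 1] -> forall x, D (J t x).
Hypothesis JK : forall t, t \in `[0, 1] -> forall x, A t (J t x) = x.
Hypothesis AK : forall t, t \in `[0, 1] -> forall x, D x -> J t (A t x) = x.

Definition real_quotient x (p : R * R) : V :=
  (p.2 - p.1)^-1 *: (A p.2 (J p.1 x) - x).

Definition quotients_extend := forall x, exists2 g : R * R -> V,
  {within square01, continuous g} &
  forall p, off_diagonal p -> g p = real_quotient x p.

Definition strongly_C1 := forall x, D x -> exists u' : R -> V,
  (forall t, t \in `[0, 1] -> is_derivative01 (A ^~ x) t (u' t)) /\
  {within `[0, 1], continuous u'}.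

Lemma AJ_linear s t : s \in `[0, 1] -> t \in `[0, 1] -> linear (A t \o J s).
Proof.
move=> s01 t01 a x y /=; rewrite J_linear//.
by apply: A_linear => //; exact: J_dom.
Qed.

(** The closed graph theorem, as the case of a one-element family: the graph is the preimage of that
    of [A t] under the continuous map applying [J s] to the first component. *)
Lemma AJ_bounded s t : s \in `[0, 1] -> t \in `[0, 1] ->
  exists2 M, 0 <= M & forall x, `|A t (J s x)| <= M * `|x|.
Proof.
move=> s01 t01.
have [||M M0 AM] := @closed_graph_uniform_boundedness R V V [set A t \o J s].
- move=> _ ->; split; first exact: AJ_linear.
  have -> : [set p : V * V | p.2 = (A t \o J s) p.1] =
      (fun p => (J s p.1, p.2)) @^-1` [set p | D p.1 /\ p.2 = A t p.1].
    by apply/seteqP; split=> p /= => [->|[]//]; split=> //; exact: J_dom.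
  apply: preimage_closed; last exact: A_closed.
  move=> p _.
  have Jp : (fun p : V * V => J s p.1) @ p --> J s p.1.
    by apply: continuous_comp; [exact: cvg_fst|exact: J_continuous].
  exact: (@cvg_pair _ _ _ (nbhs p) (nbhs (J s p.1)) (nbhs p.2) _ _ _
    (fun p => J s p.1) snd Jp cvg_snd).
- by move=> x; exists `|A t (J s x)| => f ->.
by exists M => // x; exact: (AM (A t \o J s) erefl).
Qed.

(** The difference quotient of [A(.) x] between [t] and [s] is [real_quotient (A t x) (t, s)], which
    tends to [G (A t x) (t, t)]. Differentiability makes [A t x] continuous in [t], and the uniform
    Lipschitz bound then makes the derivative continuous. *)
Lemma quotients_extend_C1 : quotients_extend -> strongly_C1.
Proof.
move=> qE.
have [G GP] : {G : V -> R * R -> V & forall x,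
    {within square01, continuous (G x)} /\
    forall p, off_diagonal p -> G x p = real_quotient x p}.
  apply: (@choice _ _ (fun x g => {within square01, continuous g} /\
    forall p, off_diagonal p -> g p = real_quotient x p)).
  by move=> x; have [g gc gq] := qE x; exists g.
have [||||M M0 GM] := @uniform_lipschitz R V (fun p x => real_quotient x p) G.
- move=> p [p1 [p2 _]] a x y; rewrite /real_quotient.
  have /= -> := AJ_linear p1 p2 a x y.
  by rewrite opprD addrACA -scalerBr scalerDr !scalerA mulrC.
- move=> p [p1 [p2 _]]; have [M M0 AM] := AJ_bounded p1 p2.
  exists (`|(p.2 - p.1)^-1| * (M + 1)) => x.
  rewrite normrZ -mulrA ler_wpM2l// (le_trans (ler_normB _ _))//.
  by rewrite mulrDl mul1r lerD2r.
- by move=> x; exact: (GP x).1.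
- by move=> x p; exact: (GP x).2.
have diag01 : {homo (fun t : R => (t, t)) : t / `[0, 1]%classic t >-> square01 t}.
  by move=> t t01; split.
move=> x Dx; exists (fun t => G (A t x) (t, t)).
have der t : t \in `[0, 1] -> is_derivative01 (A ^~ x) t (G (A t x) (t, t)).
  move=> t01; rewrite /is_derivative01.
  have /subspace_continuousP/(_ (t, t) (diag01 t t01)) Gtt := (GP (A t x)).1.
  apply/cvgrPdist_le => e e0.
  move/cvgrPdist_le : Gtt => /(_ e e0); rewrite near_withinE => nG.
  rewrite near_withinE /dnbhs near_withinE.
  have : \forall s \near t, square01 (t, s) ->
      `|G (A t x) (t, t) - G (A t x) (t, s)| <= e.
    have ts : (fun s => (t, s)) @ t --> (t, t).
      exact: (@cvg_pair _ _ _ (nbhs t) (nbhs t) (nbhs t) _ _ _ (cst t) id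
        (cvg_cst _) cvg_id).
    exact: (ts _ nG).
  apply: filterS => s nGs st s01; have := nGs (conj t01 s01).
  rewrite ((GP (A t x)).2 (t, s)); last first.
    by split=> //; split=> //=; rewrite eq_sym.
  by rewrite /real_quotient /= AK.
split=> //.
apply: (lipschitz_family_continuous (G := fun y t => G y (t, t)) (M := M)).
- move=> y; apply/subspace_continuousP => t t01.
  have /subspace_continuousP/(_ (t, t) (diag01 t t01)) Gtt := (GP y).1.
  move=> B /Gtt nB.
  have ts : (fun s : R => (s, s)) @ t --> (t, t).
    exact: (@cvg_pair _ _ _ (nbhs t) (nbhs t) (nbhs t) _ _ _ id id
      cvg_id cvg_id).
  have Bts : \forall s \near t, square01 (s, s) -> B (G y (s, s)).
    exact: (ts _ nB).
  suff : \forall s \near t, `[0, 1]%classic s -> B (G y (s, s)) by [].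
  near=> s => s01; apply: (near Bts s) => //; exact: diag01.
- by move=> t t01 y z; apply: GM; exact: diag01.
apply/subspace_continuousP => t t01.
exact: is_derivative01_cvg (der t t01).
Unshelve. all: by end_near. Qed.

(** With [B(t)] the operator [A t \o J 0], [B(s)] sends [z x s] to [x], so the quotient at [(s, t)]
    applied to [x] is a divided difference of [B(.) (z x s)]. The delicate point is the continuity
    of [z x], for which no uniform bound on the inverses of [B(s)] is at hand. *)
Lemma C1_quotients_extend : strongly_C1 -> quotients_extend.
Proof.
move=> AC1.
have I0 : (0 : R) \in `[0, 1] by rewrite in_itv /= lexx ler01.
have [u' u'P] : {u' : V -> R -> V & forall z,
    (forall t, t \in `[0, 1] -> is_derivative01 (A ^~ (J 0 z)) t (u' z t)) /\
    {within `[0, 1], continuous (u' z)}}.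
  apply: (@choice _ _ (fun z u' =>
    (forall t, t \in `[0, 1] -> is_derivative01 (A ^~ (J 0 z)) t (u' t)) /\
    {within `[0, 1], continuous u'})).
  by move=> z; apply: AC1; exact: J_dom.
pose Q z := divided_difference (A ^~ (J 0 z)) (u' z).
have Qc z : {within square01, continuous (Q z)}.
  exact: divided_difference_continuous (u'P z).1 (u'P z).2.
pose q (p : R * R) z := (p.2 - p.1)^-1 *: (A p.2 (J 0 z) - A p.1 (J 0 z)).
have Qq z p : off_diagonal p -> Q z p = q p z.
  by move=> [_ [_ p12]]; rewrite /Q /divided_difference (negbTE p12).
have [||||M M0 QM] := @uniform_lipschitz R V q Q => //.
- move=> p [p1 [p2 _]] a x y; rewrite /q.
  have /= -> := AJ_linear I0 p1 a x y; have /= -> := AJ_linear I0 p2 a x y.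
  by rewrite opprD addrACA -scalerBr scalerDr !scalerA mulrC.
- move=> p [p1 [p2 _]]; have [M1 M10 AM1] := AJ_bounded I0 p1.
  have [M2 M20 AM2] := AJ_bounded I0 p2.
  exists (`|(p.2 - p.1)^-1| * (M2 + M1)) => x.
  rewrite normrZ -mulrA ler_wpM2l// (le_trans (ler_normB _ _))//.
  by rewrite mulrDl lerD.
(* The uniform bound on the divided differences makes [B(.)] Lipschitz in operator norm. *)
have B_lip s t z : s \in `[0, 1] -> t \in `[0, 1] ->
    `|A t (J 0 z) - A s (J 0 z)| <= M * `|t - s| * `|z|.
  move=> s01 t01; have [<-|st] := eqVneq s t.
    by rewrite !subrr !normr0 mulr0 mul0r.
  have ost : off_diagonal (s, t) by [].
  have := QM (s, t) (conj s01 t01) z 0; rewrite !Qq// /q /=.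
  have /= -> := linear_at0 (AJ_linear I0 s01).
  have /= -> := linear_at0 (AJ_linear I0 t01).
  rewrite !subr0 scaler0 subr0 normrZ normfV ler_pdivrMl ?mulrA.
    by rewrite [`|t - s| * M]mulrC.
  by rewrite normr_gt0 subr_eq0 eq_sym.
(* z x s is the preimage of x under A(s) A(0)^-1. *)
pose z x s := A 0 (J s x).
have zc x : {within `[0, 1], continuous (z x)}.
  have zK s : s \in `[0, 1] -> A s (J 0 (z x s)) = x.
    by move=> s01; rewrite /z AK ?JK//; exact: J_dom.
  apply/subspace_continuousP => s0 s00.
  have [N N0 AN] := AJ_bounded s00 I0.
  pose c := N * M + 1; pose m := `|z x s0| + 1.
  have NM0 : 0 <= N * M by rewrite mulr_ge0.
  have c0 : 0 < c by rewrite ltr_wpDl.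
  have m0 : 0 < m by rewrite ltr_wpDl.
  (* Both [B(s)] at [z x s] and [B(s0)] at [z x s0] equal [x], so [B(s0) w] is a difference of [B]
     at two times. Only the inverse at the fixed time [s0], bounded by [N], is applied to it. *)
  have key s : s \in `[0, 1] ->
      `|z x s - z x s0| <= N * M * `|s - s0| * `|z x s|.
    move=> s01; set w := z x s - z x s0.
    have -> : w = A 0 (J s0 (A s0 (J 0 w))) by rewrite AK ?JK//; exact: J_dom.
    rewrite (le_trans (AN _))// -!mulrA ler_wpM2l// mulrA.
    have -> : A s0 (J 0 w) = A s0 (J 0 (z x s)) - A s (J 0 (z x s)).
      rewrite (zK s)// -[X in _ = _ - X](zK s0 s00).
      exact: linear_subr (AJ_linear I0 s00) _ _.
    by rewrite [`|s - s0|]distrC; exact: B_lip.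
  apply/cvgrPdist_le => e e0; rewrite near_withinE; near=> s => s01.
  (* The bound in [key] still contains [z x s], whose norm is at most [m] plus the distance to be
     estimated. [d1] lets half of that distance be absorbed on the left, and [d2] makes the rest at
     most [e / 2]. *)
  have d1 : `|s - s0| <= 2^-1 / c.
    rewrite distrC ltW//; near: s; apply: (nbhsx_ballx s0).
    by rewrite divr_gt0.
  have d2 : `|s - s0| <= e / 2 / (c * m).
    rewrite distrC ltW//; near: s; apply: (nbhsx_ballx s0).
    by rewrite !divr_gt0// mulr_gt0.
  rewrite ler_pdivlMr// in d1; rewrite ler_pdivlMr ?mulr_gt0// in d2.
  have := key s s01; rewrite distrC.
  have : `|z x s| <= `|z x s0| + `|z x s0 - z x s|.
    by rewrite -[z x s in X in X <= _](subKr (z x s0)) ler_normB.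
  have : N * M * `|s - s0| * `|z x s| <= c * `|s - s0| * `|z x s|.
    by rewrite !ler_wpM2r// lerDl.
  set a := `|_ - z x s|; set d := `|s - s0|; set b := `|z x s|.
  move=> h1 h2 h3.
  have h4 : a <= c * d * (m + a).
    rewrite (le_trans h3)// (le_trans h1)//.
    rewrite ler_wpM2l ?mulr_ge0 ?(ltW c0) ?normr_ge0//.
    by rewrite (le_trans h2)// lerD2r lerDl.
  have h5 : c * d * a <= 2^-1 * a by rewrite ler_wpM2r ?normr_ge0// mulrC.
  have h6 : c * d * m <= e / 2 by rewrite mulrAC mulrC.
  rewrite mulrDr in h4; lra.
move=> x; exists (fun p => Q (z x p.1) p).
  apply: (lipschitz_family_continuous Qc QM).
  apply/subspace_continuousP => p [p1 _].
  have /subspace_continuousP/(_ p.1 p1) zp := zc x.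
  by move=> B /zp; exact: cvg_fst_square01.
move=> p op; rewrite Qq// /q /real_quotient /z; case: op => p1 [p2 _].
by rewrite AK//; [rewrite JK|exact: J_dom].
Unshelve. all: by end_near. Qed.

End RealCase.

(** * Conditions (Y) and (C^1) over the original scalar field *)

Section BanachCase.
Context {R : realType} {sk : scalar_kind}.
Variable X : completeNormedModType (scalar_field R sk).
Variables (D : set X) (A : R -> X -> X).

Definition Cquot_extends := forall x, exists2 g : R * R -> X,
  {within square01, continuous g} &
  forall p, off_diagonal p -> g p = Cquot D A x p.

Lemma condY_i_Cquot_extends : condY_i D A -> Cquot_extends.
Proof.
move=> Yi x; have [_ uc] := Yi x.
have [g gE gc] :=
  @unif_continuous_extension _ X off_diagonal (Cquot D A x) uc.
exists g => [|p op]; last by rewrite gE ?inE.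
exact: continuous_subspaceW square01_sub_closure_off_diagonal gc.
Qed.

Lemma Cseq_Cquot x t k : (0 < k)%N ->
  Cseq D A x t k = Cquot D A x (t - k%:R^-1, t).
Proof. by move=> k0; rewrite /Cseq /Cquot /= subKr invrK. Qed.

(** [Cseq D A x t k] is the value of [g] at [(t - 1/k, t)], at distance [1/k] from [(t, t)] whatever
    [t] is; uniform continuity of [g] does the rest. *)
Lemma Cseq_entourage x (g : R * R -> X) (V : set (X * X)) :
  {within square01, continuous g} ->
  (forall p, off_diagonal p -> g p = Cquot D A x p) ->
  entourage V -> \forall k \near \oo, forall t, t \in `[k%:R^-1, 1] ->
    V (g (t, t), Cseq D A x t k).
Proof.
move=> gc gE entV.
have /unif_continuous_subspaceP/(_ V entV)[E entE EV] :=
  compact_unif_continuous square01_compact gc.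
have [d /= d0 dE] : entourage_ (@ball R (R * R)%type) E by rewrite entourage_ballE.
near=> k => t; rewrite in_itv /= => /andP[kt t1].
have k0 : (0 < k)%N by near: k; exact: nbhs_infty_gt.
have kR : 0 < k%:R^-1 :> R by rewrite invr_gt0 ltr0n.
have tI : t \in `[0, 1] by rewrite in_itv /= t1 andbT; lra.
have tkI : t - k%:R^-1 \in `[0, 1] by rewrite in_itv /=; lra.
have kd : k%:R^-1 < d :> R.
  rewrite invf_plt ?posrE ?ltr0n//; near: k.
  exact: nbhs_infty_gtr.
rewrite Cseq_Cquot// -gE; last first.
  by split=> //; split=> //=; rewrite -subr_eq0 addrAC subrr sub0r oppr_eq0 gt_eqF.
apply: EV => //; apply: dE; split=> /=; last exact: ballxx.
by rewrite /ball /= subKr gtr0_norm.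
Unshelve. all: by end_near. Qed.

Lemma Cseq_cvg x (g : R * R -> X) t :
  {within square01, continuous g} ->
  (forall p, off_diagonal p -> g p = Cquot D A x p) ->
  t \in `]0, 1] -> Cseq D A x t k @[k --> \oo] --> g (t, t).
Proof.
move=> gc gE; rewrite in_itv /= => /andP[t0 t1].
apply/cvg_app_entourageP => V /(Cseq_entourage gc gE) Vk.
near=> k; apply: (near Vk k) => //.
rewrite in_itv /= t1 andbT ltW// invf_plt ?posrE//; last first.
  by rewrite ltr0n; near: k; exact: nbhs_infty_gt.
near: k; exact: nbhs_infty_gtr.
Unshelve. all: by end_near. Qed.

Lemma Clim_eq x (g : R * R -> X) t :
  {within square01, continuous g} ->
  (forall p, off_diagonal p -> g p = Cquot D A x p) ->
  t \in `]0, 1] -> Clim D A x t = g (t, t).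
Proof. by move=> gc gE t01; apply: cvg_lim => //; exact: Cseq_cvg. Qed.

Lemma Cquot_extends_condY : Cquot_extends -> condY D A.
Proof.
move=> qE; split=> x; have [g gc gE] := qE x.
- split; last first.
    apply: (@eq_unif_continuous_subspace _ _ _ g) => [p|]; first by rewrite inE => /gE.
    apply: (unif_continuous_subspaceW off_diagonal_sub_square01).
    exact: compact_unif_continuous square01_compact gc.
  (* The bound is found for the real norm and then carried into the scalar field, where it is a real
     element as required. *)
  have [M [_ /(_ (M + 1)) gM]] := @compact_bounded R (realify X) _
    (continuous_compact gc square01_compact).
  exists (of_real sk (M + 1)); split.
    by rewrite realE -(rmorph0 (of_real sk)) !ler_of_real -realE num_real.
  move=> N MN p op /=; rewrite -gE// (le_trans _ (ltW MN))//.
  rewrite -of_real_norm_realify ler_of_real; apply: gM; first by rewrite ltrDl.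
  by exists p => //; exact: off_diagonal_sub_square01.
- split=> [t t01|e e0]; first by apply: cvgP; exact: Cseq_cvg.
  have entV := @entourage_ball _ X (PosNum e0).
  have := Cseq_entourage gc gE entV; apply: filter_app.
  near=> k => Vk t tk.
  have t01 : t \in `]0, 1].
    move: tk; rewrite !in_itv /= => /andP[kt ->]; rewrite andbT (lt_le_trans _ kt)//.
    by rewrite invr_gt0 ltr0n; near: k; exact: nbhs_infty_gt.
  have := Vk t tk; rewrite (Clim_eq gc gE)//= -ball_normE /= distrC; exact: ltW.
- apply/subspace_continuousP => t /= t01; rewrite /from_subspace (Clim_eq gc gE)//.
  have tI : t \in `[0, 1] by move: t01; rewrite !in_itv /= => /andP[/ltW-> ->].
  have /subspace_continuousP/(_ (t, t) (conj tI tI)) gtt := gc.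
  move=> B /gtt nB.
  have ts : (fun s : R => (s, s)) @ t --> (t, t).
    exact: (@cvg_pair _ _ _ (nbhs t) (nbhs t) (nbhs t) _ _ _ id id
      cvg_id cvg_id).
  have Bts : \forall s \near t, square01 (s, s) -> B (g (s, s)).
    exact: (ts _ nB).
  suff : \forall s \near t, `]0, 1]%classic s -> B (Clim D A x s) by [].
  near=> s => s01; rewrite (Clim_eq gc gE)//; apply: (near Bts s) => //.
  by split; move: s01; rewrite /= !in_itv /= => /andP[/ltW-> ->].
Unshelve. all: by end_near. Qed.

Hypothesis A_inv : forall t : R, t \in `[0, 1] ->
  [/\ linear_on D (A t), closed_operator D (A t) & has_bounded_inverse D (A t)].

Lemma op_inv_continuous t : t \in `[0, 1] -> continuous (op_inv D (A t)).
Proof.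
move=> /A_inv[_ _ [_ [lJ [M JM]]]].
pose g : {linear X -> X} :=
  HB.pack (op_inv D (A t)) (GRing.isLinear.Build _ _ _ _ _ lJ).
apply: (linear_bounded_continuous g).1; apply/linear_boundedP.
(* [M] is a scalar that need not be real when [X] is trivial, so its norm serves as the bound. *)
exists `|M|; split=> [|N MN x]; first exact: normr_real.
rewrite (le_trans (JM x))// (le_trans (real_ler_norm _))//.
  by apply: ger0_real; rewrite (le_trans _ (JM x)).
by rewrite normrM normr_id ler_wpM2r// ltW.
Qed.

Lemma op_inv_dom t : t \in `[0, 1] -> forall x, D (op_inv D (A t) x).
Proof.
move=> /A_inv[_ _ [[_ _ Asurj] _]] x.
by apply: (surjpinv_image_sub (dflt := fun=> 0) Asurj); exists x.
Qed.

Lemma op_invK t : t \in `[0, 1] -> cancel (op_inv D (A t)) (A t).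
Proof.
move=> /A_inv[_ _ [[_ _ Asurj] _]] x; apply: pinvK.
by rewrite inE; exact: Asurj.
Qed.

Lemma op_invKV t : t \in `[0, 1] ->
  forall x, D x -> op_inv D (A t) (A t x) = x.
Proof.
by move=> /A_inv[_ _ [[_ Ainj _] _]] x Dx; apply: pinvKV => //; rewrite inE.
Qed.

(** Limits and continuity in [X] and in [realify X] agree by conversion, and real scaling is scaling
    by [of_real], so the real case applies verbatim. *)
Lemma Cquot_extends_condC1 : Cquot_extends <-> condC1 D A.
Proof.
pose Y := realify X.
have Alin t : t \in `[0, 1] -> @linear_on R Y D (A t).
  by move=> /A_inv[lA _ _] a x y Dx Dy; exact: lA.
have Jlin t : t \in `[0, 1] -> linear (op_inv D (A t) : Y -> Y).
  by move=> /A_inv[_ _ [_ [lJ _]]] a x y; exact: lJ.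
have Acl t : t \in `[0, 1] -> @closed_operator R Y D (A t).
  by move=> /A_inv[].
split.
  exact: (@quotients_extend_C1 R Y D A (fun t => op_inv D (A t)) Alin Acl Jlin
    op_inv_continuous op_inv_dom op_invKV).
exact: (@C1_quotients_extend R Y D A (fun t => op_inv D (A t)) Alin Acl Jlin
  op_inv_continuous op_inv_dom op_invK op_invKV).
Qed.

End BanachCase.

Theorem theorem2p2 (R : realType) (sk : scalar_kind)
    (X : completeNormedModType (scalar_field R sk))
    (D : set X) (A : R -> X -> X) :
  submod_closed (mem D) ->
  dense D ->
  (forall t : R, t \in `[0, 1] ->
     [/\ linear_on D (A t), closed_operator D (A t)
       & has_bounded_inverse D (A t)]) ->
  (condY D A <-> condC1 D A).
Proof.
move=> _ _ A_inv; split=> [[/condY_i_Cquot_extends qE _ _]|AC1].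
  exact/(Cquot_extends_condC1 A_inv).
exact/Cquot_extends_condY/(Cquot_extends_condC1 A_inv).
Qed.
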